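(* Let $K$ be any field of positive characteristic $p$. Then the polynomial $f=x_1^p$ in the free algebra $K\langle X\rangle$ is algebraically concise but not ideally concise.
   Context: ''Algebra'' means a not necessarily unital associative algebra over the fixed field $K$. $K\langle X\rangle$ is the free associative $K$-algebra on $X=\{x_1,x_2,\ldots\}$. For an algebra $A$ and $f=f(x_1,\ldots,x_n)\in K\langle X\rangle$, let $\mathcal S_A(f)$, $\mathcal A_A(f)$ and $\mathcal I_A(f)$ be, respectively, the $K$-subspace, the $K$-subalgebra and the two-sided ideal of $A$ generated by the set of $f$-values $\{f(a_1,\ldots,a_n): a_1,\ldots,a_n\in A\}$. The polynomial $f$ is algebraically concise (respectively, ideally concise) if, for every $K$-algebra $A$, $\mathcal A_A(f)$ (respectively, $\mathcal I_A(f)$) is finite-dimensional whenever $\mathcal S_A(f)$ is finite-dimensional. *)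

(* Defs.v *)
From HB Require Import structures.
From mathcomp Require Import all_boot all_order all_algebra finmap.
From mathcomp Require Import classical_sets.
From mathcomp Require Import monalg.

Set Implicit Arguments.
Unset Strict Implicit.
Unset Printing Implicit Defensive.

Import GRing.Theory.
Local Open Scope classical_set_scope.
Local Open Scope ring_scope.

(* MathComp's algebra structures (lalgType, algType, ...) all have a unit, so
   associative algebras without a required unit get a structure of their own. *)
HB.mixin Record Lmodule_isNuAlgebra (K : fieldType) A of GRing.Lmodule K A := {
  numul : A -> A -> A;
  numulA : associative numul;
  numulDl : left_distributive numul +%R;
  numulDr : right_distributive numul +%R;
  scale_numull : forall (c : K) (x y : A),
    c *: numul x y = numul (c *: x) y;
  scale_numulr : forall (c : K) (x y : A),
    c *: numul x y = numul x (c *: y)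
}.

#[short(type="nuAlgType")]
HB.structure Definition NuAlgebra (K : fieldType) :=
  { A of GRing.Lmodule K A & Lmodule_isNuAlgebra K A }.

Arguments numul {K s} : rename.

(* x ^ n for n > 0; there is no x ^ 0, and nuexp x 0 is a junk value. *)
Definition nuexp (K : fieldType) (A : nuAlgType K) (x : A) (n : nat) : A :=
  iterop n numul x 0.

Section FreeAlgebra.
Context (K : fieldType).

(* {malg K[{fmonom nat}]} is the free unital algebra: finitely supported
   K-valued functions on words in the letters 0, 1, 2, ... (the letter i stands
   for x_{i+1}).  The free algebra in the category of not necessarily unital
   algebras is its ideal of polynomials with no constant term. *)
Definition no_const : {pred {malg K[{fmonom nat}]}} :=
  fun f => f@_mone == 0.

Fact no_const_submod : subsemimod_closed no_const.
Proof.
split=> [|c f]; first split=> [|f g]; rewrite ?unfold_in.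
- by rewrite mcoeff0.
- by move=> /eqP f0 /eqP g0; rewrite mcoeffD f0 g0 addr0.
by move=> /eqP f0; rewrite mcoeffZ f0 mulr0.
Qed.

HB.instance Definition _ :=
  GRing.isSubSemiModClosed.Build K {malg K[{fmonom nat}]} no_const
    no_const_submod.

Record freeAlg : predArgType := FreeAlg {
  freeAlg_val :> {malg K[{fmonom nat}]};
  _ : freeAlg_val \in no_const
}.

HB.instance Definition _ := [isSub for freeAlg_val].
HB.instance Definition _ := [Choice of freeAlg by <:].
HB.instance Definition _ := [SubChoice_isSubLmodule of freeAlg by <:].

Fact freeX_subproof (i : nat) : << fmu i >> \in no_const.
Proof. by rewrite unfold_in mcoeffU1 fm1_eq1. Qed.

Definition freeX (i : nat) : freeAlg := FreeAlg (freeX_subproof i).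

Fact free_mul_subproof (f g : freeAlg) : val f * val g \in no_const.
Proof.
by case: f g => f /= /eqP f0 [g _] /=; rewrite unfold_in rmorphM /= f0 mul0r.
Qed.

Definition free_mul (f g : freeAlg) : freeAlg :=
  FreeAlg (free_mul_subproof f g).

Fact free_mulA : associative free_mul.
Proof. by move=> f g h; apply: val_inj; rewrite /= mulrA. Qed.

Fact free_mulDl : left_distributive free_mul +%R.
Proof. by move=> f g h; apply: val_inj; rewrite /= mulrDl. Qed.

Fact free_mulDr : right_distributive free_mul +%R.
Proof. by move=> f g h; apply: val_inj; rewrite /= mulrDr. Qed.

Fact scale_free_mull (c : K) (f g : freeAlg) :
  c *: free_mul f g = free_mul (c *: f) g.
Proof. by apply: val_inj; rewrite /= scalerAl. Qed.

Fact malgC_central (c : K) (f : {malg K[{fmonom nat}]}) :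
  c%:MP * f = f * c%:MP.
Proof.
rewrite !malgM_def fgmulUg fgmulgU; apply: eq_bigr => w _.
by rewrite mul1m mulm1 mulrC.
Qed.

Fact scale_free_mulr (c : K) (f g : freeAlg) :
  c *: free_mul f g = free_mul f (c *: g).
Proof.
by apply: val_inj; rewrite /= -!mul_malgC mulrA malgC_central mulrA.
Qed.

HB.instance Definition _ := Lmodule_isNuAlgebra.Build K freeAlg
  free_mulA free_mulDl free_mulDr scale_free_mull scale_free_mulr.

End FreeAlgebra.

Arguments freeX {K} i.

Section Evaluation.
Context (K : fieldType) (A : nuAlgType K).

(* The product a_{i1} * ... * a_{ik} of a nonempty word; the empty word, which
   has no value in A, never occurs with a nonzero coefficient below. *)
Definition word_eval (a : nat -> A) (w : seq nat) : A :=
  if w is i :: s then foldl (fun y j => numul y (a j)) (a i) s else 0.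

(* A polynomial involves only x_1, ..., x_n for some n, so letting a run over
   all sequences gives the same values as letting it run over n-tuples. *)
Definition eval (a : nat -> A) (f : freeAlg K) : A :=
  \sum_(w <- msupp (val f)) (val f)@_w *: word_eval a w.

Definition values (f : freeAlg K) : set A := range (eval ^~ f).

Definition is_subspace (W : set A) : Prop :=
  W 0 /\ forall (c : K) x y, W x -> W y -> W (c *: x + y).

Definition is_subalgebra (W : set A) : Prop :=
  is_subspace W /\ forall x y, W x -> W y -> W (numul x y).

Definition is_ideal (W : set A) : Prop :=
  is_subspace W /\ forall x y, W y -> W (numul x y) /\ W (numul y x).

Definition span_values (f : freeAlg K) : set A :=
  smallest is_subspace (values f).

Definition subalgebra_values (f : freeAlg K) : set A :=
  smallest is_subalgebra (values f).

Definition ideal_values (f : freeAlg K) : set A :=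
  smallest is_ideal (values f).

Definition finite_dimensional (W : set A) : Prop :=
  exists (n : nat) (b : 'I_n -> A), (forall i, W (b i)) /\
    forall x, W x -> exists c : 'I_n -> K, x = \sum_(i < n) c i *: b i.

Lemma eval_free_wide (a : nat -> A) (f : freeAlg K) (d : {fset {fmonom nat}}) :
  (msupp (val f) `<=` d)%fset ->
  eval a f = \sum_(w <- d) (val f)@_w *: word_eval a w.
Proof.
move=> sfd; rewrite /eval; apply: big_fset_incl => // w _ /mcoeff_outdom ->.
by rewrite scale0r.
Qed.

Lemma eval_freeX (a : nat -> A) (i : nat) : eval a (freeX i) = a i.
Proof.
rewrite /eval /= msuppU1 big_seq_fset1 mcoeffUU scale1r.
by rewrite /word_eval fmU.
Qed.

Lemma eval_linear (a : nat -> A) : linear (eval a).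
Proof.
move=> c f g; pose d := (msupp (val f) `|` msupp (val g))%fset.
rewrite (@eval_free_wide a f d) ?fsubsetUl// (@eval_free_wide a g d) ?fsubsetUr//.
rewrite (@eval_free_wide a _ d).
  rewrite scaler_sumr -big_split/=; apply: eq_bigr => w _.
  by rewrite mcoeffD mcoeffZ scalerDl scalerA.
apply: fsubset_trans (msuppD_le _ _) _; apply: fsetSU.
exact: msuppZ_le.
Qed.

Fact numul0 (x : A) : numul x 0 = 0.
Proof. by rewrite -(scale0r 0) -scale_numulr !scale0r. Qed.

Fact nu0mul (x : A) : numul 0 x = 0.
Proof. by rewrite -(scale0r 0) -scale_numull !scale0r. Qed.

Fact word_eval_cat (a : nat -> A) (v w : seq nat) :
  v != [::] -> w != [::] ->
  word_eval a (v ++ w) = numul (word_eval a v) (word_eval a w).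
Proof.
case: v w => [//|i v] [//|j w] _ _ /=; rewrite foldl_cat /=.
elim/last_ind: w => [//|w k IHw]; by rewrite -!cats1 !foldl_cat /= IHw numulA.
Qed.

Lemma eval_mul (a : nat -> A) (f g : freeAlg K) :
  eval a (numul f g) = numul (eval a f) (eval a g).
Proof.
pose L (h : {malg K[{fmonom nat}]}) : A :=
  \sum_(w <- msupp h) h@_w *: word_eval a w.
have Lwide (d : {fset {fmonom nat}}) h : (msupp h `<=` d)%fset ->
    L h = \sum_(w <- d) h@_w *: word_eval a w.
  move=> shd; apply: big_fset_incl => // w _ /mcoeff_outdom ->.
  by rewrite scale0r.
have L0 : L 0 = 0 by rewrite /L msupp0 big_seq_fset0.
have LD h1 h2 : L (h1 + h2) = L h1 + L h2.
  pose d := (msupp h1 `|` msupp h2)%fset.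
  rewrite (Lwide d h1) ?fsubsetUl// (Lwide d h2) ?fsubsetUr//.
  rewrite (Lwide d) ?msuppD_le// -big_split/=; apply: eq_bigr => w _.
  by rewrite mcoeffD scalerDl.
have LU c (w : {fmonom nat}) : L << c *g w >> = c *: word_eval a w.
  by rewrite (Lwide [fset w]%fset) ?msuppU_le// big_seq_fset1 mcoeffUU.
rewrite -[LHS]/(L (val f * val g)) malgME (big_morph L LD L0) /eval.
rewrite (big_morph (fun x => numul x _) (fun x y => numulDl x y _) (nu0mul _)).
rewrite big_seq [RHS]big_seq; apply: eq_bigr => v fv; rewrite (big_morph L LD L0).
rewrite (big_morph (numul _) (numulDr _) (numul0 _)).
rewrite big_seq [RHS]big_seq; apply: eq_bigr => w gw; rewrite LU.
rewrite -scale_numull -scale_numulr scalerA fmM word_eval_cat//.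
  apply: contraL fv => /eqP v1; rewrite -mcoeff_eq0.
  suff -> : v = mone by exact: (valP f).
  by apply: val_inj; rewrite /= v1 fm1.
apply: contraL gw => /eqP w1; rewrite -mcoeff_eq0.
suff -> : w = mone by exact: (valP g).
by apply: val_inj; rewrite /= w1 fm1.
Qed.

Lemma eval_exp (a : nat -> A) (f : freeAlg K) (n : nat) :
  (0 < n)%N -> eval a (nuexp f n) = nuexp (eval a f) n.
Proof.
case: n => // n _; rewrite /nuexp !iteropS.
by elim: n => //= n IHn; rewrite eval_mul IHn.
Qed.

End Evaluation.

Arguments values {K} A f.
Arguments span_values {K} A f.
Arguments subalgebra_values {K} A f.
Arguments ideal_values {K} A f.

Definition algebraically_concise (K : fieldType) (f : freeAlg K) : Prop :=
  forall A : nuAlgType K,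
    finite_dimensional (span_values A f) ->
    finite_dimensional (subalgebra_values A f).

Definition ideally_concise (K : fieldType) (f : freeAlg K) : Prop :=
  forall A : nuAlgType K,
    finite_dimensional (span_values A f) ->
    finite_dimensional (ideal_values A f).

(* Main.v *)
Require Import Defs.
From HB Require Import structures.
From mathcomp Require Import all_boot all_order all_algebra classical_sets.

(* Let S be the span of the p-th powers.  The commutator [y^p, x] telescopes into
   the part of (y + [y, x])^p linear in [y, x], so it lies in S, and S is a Lie
   ideal.  Hence letters from a basis u_1, ..., u_n of S commute in any product
   modulo shorter products; a product of more than n (p - 1) letters before the
   last one repeats some u_i at least p times, and u_i^p is again in S, so the
   product is a combination of shorter ones.
   For the negative part, in the trivial extension of K by a module M of infinite
   dimension one has (a, m)^p = (a^p, 0): the p-th powers span a line, but this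
   line contains the unit. *)

Set Implicit Arguments.
Unset Strict Implicit.
Unset Printing Implicit Defensive.

(** * Spans, and recovering coefficients by Vandermonde *)

Section Subspaces.
Import GRing.Theory.
Local Open Scope classical_set_scope.
Local Open Scope ring_scope.
Context (K : fieldType) (A : nuAlgType K).
Implicit Types (W G : set A) (x y : A).

Definition nuspan G : set A := smallest (@is_subspace K A) G.

Lemma nuspan_subspace G : is_subspace (nuspan G).
Proof.
split=> [M [[]]//|c x y Gx Gy M MG].
by have [[_ ML] _] := MG; apply: ML (Gx M MG) (Gy M MG).
Qed.

Lemma subspaceZ W c x : is_subspace W -> W x -> W (c *: x).
Proof. by move=> [W0 WL] Wx; rewrite -[_ *: _]addr0; apply: WL. Qed.

Lemma subspaceD W x y : is_subspace W -> W x -> W y -> W (x + y).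
Proof. by move=> [_ WL] Wx Wy; rewrite -[x]scale1r; apply: WL. Qed.

Lemma subspaceB W x y : is_subspace W -> W x -> W y -> W (x - y).
Proof.
move=> Wsub Wx Wy; apply: subspaceD => //.
by rewrite -scaleN1r; apply: subspaceZ.
Qed.

Lemma subspace_sum W (I : Type) (r : seq I) (F : I -> A) :
  is_subspace W -> (forall i, W (F i)) -> W (\sum_(i <- r) F i).
Proof.
move=> Wsub WF; apply: big_ind => //; first exact: Wsub.1.
by move=> x y; apply: subspaceD.
Qed.

(** The preimage of [W] under [f] is a subspace containing [G], hence contains its span. *)
Lemma nuspan_linear (f : A -> A) G W : linear f -> is_subspace W ->
  (forall g, G g -> W (f g)) -> forall x, nuspan G x -> W (f x).
Proof.
move=> fL [W0 WL] fG x Gx; apply: (Gx [set y | W (f y)]); split=> [|//].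
split=> [|c y z Wy Wz] /=; last by rewrite fL; apply: WL.
by have := fL (-1) 0 0; rewrite scaler0 addr0 scaleN1r addNr => ->.
Qed.

Lemma numull_linear x : linear (numul x).
Proof. by move=> c y z; rewrite numulDr -scale_numulr. Qed.

Lemma numulr_linear x : linear (numul^~ x).
Proof. by move=> c y z; rewrite numulDl -scale_numull. Qed.

Lemma numulBr x y z : numul x (y - z) = numul x y - numul x z.
Proof. by rewrite addrC -scaleN1r numull_linear scaleN1r addrC. Qed.

Lemma numulBl x y z : numul (y - z) x = numul y x - numul z x.
Proof. by rewrite addrC -scaleN1r numulr_linear scaleN1r addrC. Qed.

Lemma finite_dimensional_nuspan (T : finType) (g : T -> A) :
  finite_dimensional (nuspan (range g)).
Proof.
exists #|T|, (fun i => g (enum_val i)); split=> [i|x Gx].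
  by apply: sub_gen_smallest; exists (enum_val i).
apply: (Gx [set x | exists c : 'I_#|T| -> K, x = \sum_i c i *: g (enum_val i)]).
split=> [|_ [t _ <-]] /=.
  split=> [|c _ _ [d ->] [e ->]].
    by exists (fun=> 0); rewrite big1// => i _; rewrite scale0r.
  exists (fun i => c * d i + e i).
  rewrite scaler_sumr -big_split; apply: eq_bigr => i _.
  by rewrite scalerA scalerDl.
exists (fun i => (i == enum_rank t)%:R).
rewrite (bigD1 (enum_rank t))//= eqxx scale1r enum_rankK big1 ?addr0// => i.
by move=> /negPf ->; rewrite scale0r.
Qed.

(** The Vandermonde matrix of distinct scalars is invertible; column [i] of its inverse combines the
    given sums into [v i]. *)
Lemma vandermonde_subspace W n (t : 'I_n -> K) (v : nat -> A) :
  is_subspace W -> injective t ->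
  (forall j, W (\sum_(i < n) t j ^+ i *: v i)) -> forall i : 'I_n, W (v i).
Proof.
move=> Wsub t_inj Wv i; pose V := Vandermonde n (\row_j t j).
have Vunit : V \in unitmx.
  rewrite unitmxE unitfE det_Vandermonde prodf_seq_neq0.
  apply/allP => j _; rewrite prodf_seq_neq0; apply/allP => k _.
  by apply/implyP => jk; rewrite !mxE subr_eq0 (inj_eq t_inj) neq_ltn jk orbT.
suff -> : v i = \sum_j invmx V j i *: \sum_(k < n) t j ^+ k *: v k.
  by apply: subspace_sum => // j; apply: subspaceZ.
under eq_bigr => j _ do rewrite scaler_sumr.
have VV (k : 'I_n) :
    \sum_j invmx V j i *: (t j ^+ k *: v k) = (k == i)%:R *: v k.
  have := congr1 (fun M : 'M_n => M k i) (mulmxV Vunit).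
  rewrite !mxE => <-; rewrite scaler_suml.
  by apply: eq_bigr => j _; rewrite scalerA !mxE mulrC.
rewrite exchange_big (eq_bigr _ (fun k _ => VV k)) (bigD1 i)//= eqxx scale1r.
by rewrite big1 ?addr0// => k /negPf ->; rewrite scale0r.
Qed.

End Subspaces.

(** * Expansion of powers of y + t x by degree in x *)

Section Polarization.
Import GRing.Theory.
Local Open Scope ring_scope.
Context (K : fieldType) (A : nuAlgType K).
Implicit Types x y : A.

(** The recursion starts at exponent 2, since [nuexp x 0] is not a unit. *)
Lemma nuexpS x n : nuexp x n.+2 = numul x (nuexp x n.+1).
Proof. by []. Qed.

(* The degree-one part in x of (y + x)^(n+1). *)
Fixpoint polar y x n : A :=
  if n is m.+1 then numul y (polar y x m) + numul x (nuexp y n) else x.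

Lemma nuexpDZ y x n : exists v : nat -> A,
  [/\ v 1 = polar y x n, v n.+1 = nuexp x n.+1,
      forall i, (n.+1 < i)%N -> v i = 0
    & forall t, nuexp (y + t *: x) n.+1 = \sum_(i < n.+2) t ^+ i *: v i].
Proof.
(* The induction step for [v 1] also needs the value of [v 0]. *)
suff [v [_ v1 vn vhi vE]] : exists v : nat -> A,
  [/\ v 0%N = nuexp y n.+1, v 1%N = polar y x n, v n.+1 = nuexp x n.+1,
      forall i, (n.+1 < i)%N -> v i = 0
    & forall t, nuexp (y + t *: x) n.+1 = \sum_(i < n.+2) t ^+ i *: v i].
  by exists v.
elim: n => [|n [v [v0 v1 vn vhi vE]]].
  exists (fun i => if i is j.+1 then if j is 0 then x else 0 else y).
  split=> // [[|[|i]]//|t].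
  by rewrite !big_ord_recl big_ord0 /= expr0 scale1r expr1 addr0.
(* Multiplying on the left by y + t x keeps the degree of the y-part and raises that of the x-part
   by one. *)
exists (fun i => numul y (v i) + (if i is j.+1 then numul x (v j) else 0)).
split.
- by rewrite v0 addr0.
- by rewrite v1 v0.
- by rewrite vhi ?numul0 ?add0r ?vn.
- case=> // i ni; rewrite !vhi// ?numul0 ?addr0//; exact: ltnW.
move=> t; rewrite nuexpS vE numulDl.
have numul_sum z : numul z (\sum_(i < n.+2) t ^+ i *: v i)
    = \sum_(i < n.+2) t ^+ i *: numul z (v i).
  rewrite (big_morph (numul z) (numulDr z) (numul0 z)).
  by apply: eq_bigr => i _; rewrite scale_numulr.
rewrite !numul_sum; under [RHS]eq_bigr => i _ do rewrite scalerDr.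
rewrite big_split; congr (_ + _).
  by rewrite [RHS]big_ord_recr /= vhi// numul0 scaler0 addr0.
rewrite [RHS]big_ord_recl /= scaler0 add0r; apply: eq_bigr => i _.
by rewrite -scale_numull scalerA exprSr.
Qed.

(** Unrolled, [polar y z n] is the sum of the y^i z y^(n-i); for z = y x - x y consecutive terms
    cancel, leaving the two ends. *)
Lemma polar_commutator y x n :
  polar y (numul y x - numul x y) n
  = numul (nuexp y n.+1) x - numul x (nuexp y n.+1).
Proof.
elim: n => // n IHn; rewrite [LHS]/= IHn numulBr numulBl !nuexpS !numulA.
by rewrite addrA subrK.
Qed.

Lemma iter_numul x y n : iter n.+1 (numul x) y = numul (nuexp x n.+1) y.
Proof. by elim: n => // n IHn; rewrite iterS IHn nuexpS numulA. Qed.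

End Polarization.

(** * The span of the p-th powers is a Lie ideal *)

Section PowerSpan.
Import GRing.Theory.
Local Open Scope classical_set_scope.
Local Open Scope ring_scope.
Context (K : fieldType) (A : nuAlgType K) (p : nat) (charK : p \in [pchar K]).
Implicit Types (x y : A) (W : set A).

Lemma values_freeX_exp :
  values A (nuexp (freeX 0%N : freeAlg K) p) = range (fun x : A => nuexp x p).
Proof.
have p_gt0 := prime_gt0 (pcharf_prime charK).
apply/seteqP; split=> [_ [a _ <-]|_ [x _ <-]].
  by exists (a 0%N); rewrite // eval_exp// eval_freeX.
by exists (fun=> x); rewrite //= eval_exp// eval_freeX.
Qed.

Lemma natr_inj_ltp : injective (fun j : 'I_p => j%:R : K).
Proof.
move=> i j; wlog ij : i j / (i <= j)%N.
  by move=> H; case/orP: (leq_total i j) => ? e; [apply: H|symmetry; apply: H].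
move=> /esym/eqP; rewrite -subr_eq0 -natrB// -(dvdn_pcharf charK).
move=> /dvdnP[k jk].
(* Here j - i = k p: k = 0 forces i = j, and k > 0 forces p <= j. *)
have := ltn_ord j; apply/contraTeq => /eqP ij'.
case: k jk => [/eqP|k].
  rewrite mul0n subn_eq0 => ji.
  by case: ij'; apply/val_inj/anti_leq; rewrite ij.
move=> jk; rewrite -leqNgt; apply: leq_trans (leq_subr i j).
by rewrite jk mulSn leq_addr.
Qed.

(* On the prime field t^p = t, so the top term of (y + t x)^p is absorbed by the
   linear one, and the p points of the prime field separate the p remaining
   coefficients; this avoids assuming that K is infinite. *)
Lemma polar_mem W y x : is_subspace W ->
  (forall z : A, W (nuexp z p)) -> W (polar y x p.-1).
Proof.
move=> Wsub Wpow; have p_gt1 := prime_gt1 (pcharf_prime charK).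
have [v [<- vp _ vE]] := nuexpDZ y x p.-1.
rewrite prednK ?(ltnW p_gt1)// in vp vE.
pose u i := v i + (i == 1%N)%:R *: v p.
suff Wu : W (u 1%N).
  have -> : v 1%N = u 1%N - v p by rewrite /u scale1r addrK.
  by apply: subspaceB => //; rewrite vp.
apply: (vandermonde_subspace Wsub natr_inj_ltp _ (Ordinal p_gt1)) => j.
suff <- : nuexp (y + j%:R *: x) p = \sum_(i < p) j%:R ^+ i *: u i by [].
rewrite vE big_ord_recr /=; under [RHS]eq_bigr => i _ do rewrite scalerDr.
rewrite big_split; congr (_ + _).
rewrite (bigD1 (Ordinal p_gt1))//= big1 => [|i]; last first.
  by rewrite -val_eqE /= => /negPf ->; rewrite scale0r scaler0.
by rewrite scale1r addr0 expr1 -(pFrobenius_autE charK) pFrobenius_aut_nat.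
Qed.

Lemma nuexp_commutator_mem W y x : is_subspace W ->
  (forall z : A, W (nuexp z p)) ->
  W (numul (nuexp y p) x - numul x (nuexp y p)).
Proof.
move=> Wsub Wpow; have p_gt0 := prime_gt0 (pcharf_prime charK).
by have := polar_mem y (numul y x - numul x y) Wsub Wpow;
  rewrite polar_commutator prednK.
Qed.

Lemma span_powers_lie_ideal s x :
  span_values A (nuexp (freeX 0%N) p) s ->
  span_values A (nuexp (freeX 0%N) p) (numul s x - numul x s).
Proof.
rewrite /span_values values_freeX_exp => Ss.
apply: (nuspan_linear (f := fun s => numul s x - numul x s)) Ss => [c y z||].
- rewrite numulr_linear numull_linear scalerBr opprD !addrA; congr (_ + _).
  by rewrite addrAC.
- exact: nuspan_subspace.
move=> _ [y _ <-]; set W := smallest _ _.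
apply: (@nuexp_commutator_mem W); first exact: nuspan_subspace.
by move=> z; apply: sub_gen_smallest; exists z.
Qed.

End PowerSpan.

(** * Shortening products of letters that commute modulo shorter products *)

Section Words.
Import GRing.Theory.
Local Open Scope classical_set_scope.
Local Open Scope ring_scope.
Context (K : fieldType) (A : nuAlgType K) (p : nat) (p_gt1 : (1 < p)%N).
Context (S : set A).
Hypothesis S_comm : forall s x, S s -> S (numul s x - numul x s).
Hypothesis S_pow : forall s, S s -> S (nuexp s p).
Context (n : nat) (b : 'I_n -> A).
Hypothesis Sb : forall i, S (b i).
Hypothesis b_span : forall x, S x ->
  exists c : 'I_n -> K, x = \sum_(i < n) c i *: b i.

(** Keeping the last factor [x] apart gives the empty word a meaning although [A] may have no
    unit. *)
Definition word_mul (w : seq 'I_n) (x : A) : A :=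
  foldr (fun i => numul (b i)) x w.

(* The span of the products of at most m + 1 letters. *)
Definition filt (m : nat) : set A :=
  nuspan (range (fun wj : m.-bseq 'I_n * 'I_n => word_mul wj.1 (b wj.2))).

Lemma filt_subspace m : is_subspace (filt m).
Proof. exact: nuspan_subspace. Qed.

Lemma filt_word m w j : (size w <= m)%N -> filt m (word_mul w (b j)).
Proof. by move=> wm; apply: sub_gen_smallest; exists (Bseq wm, j). Qed.

Lemma filt_ind m W : is_subspace W ->
  (forall w j, (size w <= m)%N -> W (word_mul w (b j))) -> filt m `<=` W.
Proof.
by move=> Wsub Ww x; apply; split=> // _ [[w j] _ <-]; apply/Ww/size_bseq.
Qed.

Lemma filt_mono m k : (m <= k)%N -> filt m `<=` filt k.
Proof.
move=> mk; apply: filt_ind => [|w j wm]; first exact: filt_subspace.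
by apply: filt_word; apply: leq_trans mk.
Qed.

Lemma filt_letters m s : S s -> filt m s.
Proof.
move=> /b_span[c ->]; have Fsub := filt_subspace m.
apply: (subspace_sum _ Fsub) => i; apply: (subspaceZ _ Fsub).
exact: (@filt_word m [::] i).
Qed.

Lemma filt_mul m s x : S s -> filt m x -> filt m.+1 (numul s x).
Proof.
move=> Ss; have Fsub := filt_subspace m.+1.
apply: nuspan_linear => // [|_ [[w j] _ <-] /=]; first exact: numull_linear.
have [c ->] := b_span Ss.
rewrite (big_morph (numul^~ _) (fun x y => numulDl x y _) (nu0mul _)).
apply: (subspace_sum _ Fsub) => i; rewrite -scale_numull.
apply: (subspaceZ _ Fsub).
by apply: (@filt_word _ (i :: w) j); rewrite ltnS size_bseq.
Qed.

Lemma filt_word_mul w m x : filt m x -> filt (size w + m) (word_mul w x).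
Proof. by move=> Fx; elim: w => //= i w; apply: filt_mul. Qed.

(** Moving [b i] leftwards past [b j] costs a commutator, which lies in [S] by [S_comm] and so
    counts as one letter instead of two. *)
Lemma word_mul_front w i s : i \in w -> S s ->
  filt (size w).-1 (word_mul w s - numul (b i) (word_mul (rem i w) s)).
Proof.
move=> + Ss; elim: w => //= j w IHw; rewrite inE eq_sym.
case: eqVneq => [->|ji] /=.
  by rewrite subrr => _; case: (filt_subspace (size w)).
move=> iw; have w_gt0 : (0 < size w)%N by case: (w) iw.
have Fsub := filt_subspace (size w).
set y := word_mul (rem i w) s.
have Fy : filt (size w).-1 y.
  rewrite -[(size w).-1]addn0 -(size_rem iw).
  exact: filt_word_mul (filt_letters Ss).
have -> : numul (b j) (word_mul w s) - numul (b i) (numul (b j) y)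
    = numul (b j) (word_mul w s - numul (b i) y)
      + numul (numul (b j) (b i) - numul (b i) (b j)) y.
  by rewrite numulBr numulBl !numulA addrA subrK.
have SF z t : S z -> filt (size w).-1 t -> filt (size w) (numul z t).
  by move=> Sz Ft; rewrite -(prednK w_gt0); apply: filt_mul.
by apply: (subspaceD Fsub); apply: SF => //; [apply: IHw | apply: S_comm].
Qed.

Lemma word_mul_gather w i k s : (k <= count_mem i w)%N -> S s ->
  exists2 w', size w = (size w' + k)%N
    & filt (size w).-1 (word_mul w s - iter k (numul (b i)) (word_mul w' s)).
Proof.
move=> + Ss; elim: k w => [|k IHk] w kw.
  by exists w; rewrite ?addn0//= subrr; case: (filt_subspace (size w).-1).
have iw : i \in w by rewrite -has_pred1 has_count (leq_trans _ kw).
have w_gt0 : (0 < size w)%N by case: (w) iw.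
have [|w' w'E Fw'] := IHk (rem i w).
  by rewrite count_rem iw /= eqxx leq_subRL ?add1n// -has_count has_pred1.
have wE : size w = (size w' + k.+1)%N by rewrite addnS -w'E size_rem// prednK.
exists w' => //; have Fsub := filt_subspace (size w).-1.
rewrite -(subrKA (numul (b i) (word_mul (rem i w) s))) iterS -numulBr.
apply: (subspaceD Fsub); first exact: word_mul_front.
(* If [rem i w] is empty, the predecessor of its size does not drop, and multiplying the error by
   [b i] would leave [filt 0]; but then that error is zero. *)
case: (posnP (size (rem i w))) => [r0|r_gt0]; last first.
  by rewrite -(size_rem iw) -(prednK r_gt0); apply: filt_mul.
have [k0 w0] : k = 0 /\ w' = [::].
  by move: w'E; rewrite r0; case: (k) (w') => [|?] [].
by rewrite k0 w0 (size0nil r0) /= subrr numul0; case: Fsub.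
Qed.

Lemma size_sum_count (w : seq 'I_n) : size w = (\sum_i count_mem i w)%N.
Proof.
elim: w => [|i w IHw] /=; first by rewrite big1.
rewrite big_split /= -IHw (bigD1 i)//= eqxx big1 ?addn0// => j.
by rewrite eq_sym => /negPf ->.
Qed.

(** By pigeonhole some letter occurs at least p times; gathering p copies in front gives its p-th
    power, an element of [S] that counts as a single letter. *)
Lemma long_word_mul w s : (n * p.-1 < size w)%N -> S s ->
  filt (size w).-1 (word_mul w s).
Proof.
move=> w_long Ss; have p_gt0 := ltnW p_gt1.
have [i pi] : exists i, (p <= count_mem i w)%N.
  apply/existsP; apply: contraLR w_long; rewrite negb_exists => /forallP small.
  rewrite -leqNgt size_sum_count -[X in (X * _)%N]card_ord -sum_nat_const.
  by apply: leq_sum => i _; rewrite -ltnS prednK// ltnNge.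
have [w' wE Fw] := word_mul_gather pi Ss.
have Fsub := filt_subspace (size w).-1.
rewrite -[word_mul w s](subrK (iter p (numul (b i)) (word_mul w' s))).
apply: (subspaceD Fsub) => [//|]; rewrite -(prednK p_gt0) iter_numul prednK//.
(* As [size w] is [size w' + p], the needed bound [size w' + 1 <= size w - 1] amounts to p >= 2. *)
apply: (@filt_mono (size w').+1); last first.
  apply: filt_mul; first exact/S_pow/Sb.
  by rewrite -[size w']addn0; exact: filt_word_mul (filt_letters Ss).
by rewrite wE -(prednK p_gt0) addnS /= -addn1 leq_add2l -ltnS prednK.
Qed.

Lemma filt_stable m : filt m `<=` filt (n * p.-1).
Proof.
elim: m => [|m IHm]; first exact: filt_mono.
have Fsub := filt_subspace (n * p.-1).
apply: filt_ind => // w j wm; have [short|long] := leqP (size w) (n * p.-1).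
  exact: filt_word.
apply: IHm; apply: (@filt_mono (size w).-1); first by case: (size w) wm.
exact: long_word_mul.
Qed.

(** The filtration stabilizes at [N], so [filt N] is closed under products: concatenated words fall
    back into it. It is then exactly the generated subalgebra. *)
Lemma subalgebra_finite_dimensional (G : set A) : G `<=` S -> S `<=` nuspan G ->
  finite_dimensional (smallest (@is_subalgebra K A) G).
Proof.
move=> GS SG; pose N := (n * p.-1)%N; have Fsub := filt_subspace N.
pose T := smallest (@is_subalgebra K A) G.
have T_alg : is_subalgebra T.
  split; first split=> [M [[[]]]//|c x y Tx Ty M MG].
    by have [[[_ WL] _] _] := MG; apply: WL (Tx M MG) (Ty M MG).
  move=> x y Tx Ty M MG.
  by have [[_ WM] _] := MG; apply: WM (Tx M MG) (Ty M MG).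
have ST : S `<=` T.
  move=> s /SG; apply; split; first by case: T_alg.
  exact: sub_gen_smallest.
rewrite -/T.
suff -> : T = filt N by exact: finite_dimensional_nuspan.
apply/seteqP; split.
  apply: smallest_sub => [|x /GS]; last exact: filt_letters.
  split=> // x y Fx Fy.
  apply: (nuspan_linear (f := numul^~ y)) Fx => // [|_ [[v j] _ <-]].
    exact: numulr_linear.
  apply: (nuspan_linear (f := numul _)) Fy => // [|_ [[w k] _ <-]] /=.
    exact: numull_linear.
  have -> : numul (word_mul v (b j)) (word_mul w (b k))
      = word_mul (v ++ j :: w) (b k).
    rewrite /word_mul foldr_cat /=.
    by elim: (bseqval v) => //= i u IHu; rewrite -numulA IHu.
  by apply: (@filt_stable (size (v ++ j :: w))); apply: filt_word.
apply: filt_ind; first by case: T_alg.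
move=> w j _; elim: w => [|i w IHw] /=; first exact: ST (Sb j).
exact: T_alg.2 (ST _ (Sb i)) IHw.
Qed.

End Words.

(** * An infinite-dimensional algebra with unit *)

Section Counterexample.
Import GRing.Theory.
Local Open Scope classical_set_scope.
Local Open Scope ring_scope.
Context (K : fieldType).

(* The trivial (square-zero) extension of K by the module {poly K}. *)
Definition triv_ext : Type := (K^o * {poly K})%type.
HB.instance Definition _ := GRing.Lmodule.on triv_ext.

Definition triv_mul (x y : triv_ext) : triv_ext :=
  (x.1 * y.1, x.1 *: y.2 + y.1 *: x.2).

Fact triv_mulA : associative triv_mul.
Proof.
move=> [a f] [b g] [c h]; congr (_, _); rewrite /= ?mulrA//.
by rewrite !scalerDr !scalerA addrA (mulrC c a) (mulrC b c) [c * b]mulrC.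
Qed.

Fact triv_mulDl : left_distributive triv_mul +%R.
Proof.
move=> [a f] [b g] [c h]; congr (_, _); rewrite /= ?mulrDl//.
by rewrite scalerDl scalerDr addrACA.
Qed.

Fact triv_mulDr : right_distributive triv_mul +%R.
Proof.
move=> [a f] [b g] [c h]; congr (_, _); rewrite /= ?mulrDr//.
by rewrite scalerDl scalerDr addrACA.
Qed.

Fact scale_triv_mull (c : K) (x y : triv_ext) :
  c *: triv_mul x y = triv_mul (c *: x) y.
Proof.
case: x y => [a f] [b g]; congr (_, _); rewrite /= ?scalerAl//.
by rewrite scalerDr !scalerA (mulrC b).
Qed.

Fact scale_triv_mulr (c : K) (x y : triv_ext) :
  c *: triv_mul x y = triv_mul x (c *: y).
Proof.
case: x y => [a f] [b g]; congr (_, _); rewrite /= ?scalerAr//.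
by rewrite scalerDr !scalerA (mulrC a).
Qed.

HB.instance Definition _ := Lmodule_isNuAlgebra.Build K triv_ext
  triv_mulA triv_mulDl triv_mulDr scale_triv_mull scale_triv_mulr.

(** The second component follows the derivative rule, so in characteristic p it vanishes at exponent
    p. *)
Lemma triv_nuexp (x : triv_ext) n :
  nuexp x n.+1 = (x.1 ^+ n.+1, (x.1 ^+ n *+ n.+1) *: x.2).
Proof.
elim: n => [|n IHn]; first by rewrite expr1 expr0 scale1r; case: x.
rewrite nuexpS IHn; congr (_, _); rewrite /= ?exprS// scalerA -scalerDl.
by congr (_ *: _); rewrite mulrnAr -exprS [RHS]mulrS addrC.
Qed.

Lemma poly_not_finitely_spanned n (g : 'I_n -> {poly K}) :
  ~ forall f, exists c : 'I_n -> K, f = \sum_i c i *: g i.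
Proof.
(* Every combination of the [g i] has size at most [d], whereas ['X^d] has size [d + 1]. *)
move=> g_span; pose d := (\max_i size (g i))%N.
have [c Xd] := g_span 'X^d; have := size_polyXn K d; rewrite Xd.
apply/eqP; rewrite neq_ltn ltnS; apply/orP; left.
apply: (leq_trans (size_sum _ _ _)); apply/bigmax_leqP => i _.
by apply: leq_trans (size_scale_leq _ _) _; apply: leq_bigmax.
Qed.

End Counterexample.

(** * The two conciseness statements for the p-th power *)

Section PowerConciseness.
Import GRing.Theory.
Local Open Scope ring_scope.
Context (K : fieldType) (p : nat) (charK : p \in [pchar K]).

Lemma power_algebraically_concise :
  algebraically_concise (nuexp (freeX 0%N : freeAlg K) p).
Proof.
move=> A [n [b [Sb b_span]]].
have p_gt1 := prime_gt1 (pcharf_prime charK).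
apply: (subalgebra_finite_dimensional p_gt1 _ _ Sb b_span) => //.
- exact: span_powers_lie_ideal.
- by move=> s _; apply: sub_gen_smallest; rewrite values_freeX_exp.
exact: sub_gen_smallest.
Qed.

Lemma power_not_ideally_concise :
  ~ ideally_concise (nuexp (freeX 0%N : freeAlg K) p).
Proof.
have p_gt0 := prime_gt0 (pcharf_prime charK).
(* [e] is the unit of [triv_ext K] and its own p-th power, so the ideal of values contains every
   [(0, f)]. *)
pose e : triv_ext K := (1, 0).
have pow_e (x : triv_ext K) : nuexp x p = x.1 ^+ p *: e.
  rewrite -(prednK p_gt0) triv_nuexp prednK//; congr (_, _) => /=.
    by rewrite [RHS]mulr1.
  by rewrite scaler0 -mulr_natr (pcharf0 charK) mulr0 scale0r.
have e_value : values (triv_ext K) (nuexp (freeX 0%N) p) e.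
  by rewrite values_freeX_exp//; exists e; rewrite // pow_e expr1n scale1r.
move=> /(_ (triv_ext K))[].
  exists 1%N, (fun=> e); split=> [_|x Sx]; first exact: sub_gen_smallest.
  pose line : set (triv_ext K) :=
    [set y | exists c : 'I_1 -> K, y = \sum_(i < 1) c i *: e]%classic.
  apply: (Sx line); split.
    split=> [|c _ _ [d ->] [d' ->]].
      by exists (fun=> 0); rewrite big_ord1 scale0r.
    exists (fun i => c * d i + d' i).
    by rewrite !big_ord1 scalerDl scalerA.
  rewrite values_freeX_exp// => _ [y _ <-].
  by exists (fun=> y.1 ^+ p); rewrite big_ord1 pow_e.
move=> n [b [_ b_span]].
(* Second components of a finite spanning family of the ideal would span [{poly K}]. *)
apply: (@poly_not_finitely_spanned K n (fun i => (b i).2)) => f.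
have [|c fE] := b_span (0, f).
  move=> M [[_ M_ideal] MG]; have [+ _] := M_ideal (0, f) e (MG _ e_value).
  suff -> : numul ((0, f) : triv_ext K) e = (0, f) by [].
  by congr (_, _); rewrite /= ?mul0r// scale0r scale1r add0r.
exists c; rewrite -[LHS]/((0, f) : triv_ext K).2 fE.
by rewrite (big_morph (fun x : triv_ext K => x.2) (id1 := 0) (op1 := +%R)).
Qed.

End PowerConciseness.

Theorem corollary1p8 (K : fieldType) (p : nat)
    (charK : p \in [pchar K]%R) :
  algebraically_concise (nuexp (freeX 0 : freeAlg K) p) /\
  ~ ideally_concise (nuexp (freeX 0 : freeAlg K) p).
Proof.
split; first exact: power_algebraically_concise.
exact: power_not_ideally_concise.
Qed.
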